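(* Consider an increasing sequence $\{a_n\}$ of positive integers together with a notion of legal decomposition such that every positive integer has a unique legal decomposition, and suppose: (1) the rule for legal decompositions acts over a fixed distance; (2) the average number of summands in the legal decompositions of $m\in[a_n,a_{n+1})$ is $\mu_n=Cn+d+o(1)$; (3) given any constant $A>0$ there is a length $L$ and a probability $p=p(A,L)>0$ which is less than or equal to the proportion of legal ways to choose summands in any segment of length $L$ that have at least $A$ summands, regardless of the choices of summands outside the segment. Then $C>0$.
   Context: Given a length $L$, a segment of summands of a legal decomposition starting at index $i$ consists of the summands taken from $\{a_i,a_{i+1},\dots,a_{i+L-1}\}$ (counted with multiplicity if the rule allows repeated summands). The legal decomposition rule acts over a fixed distance if there is a finite number $f$ such that any two segments of a decomposition separated by at least $f$ consecutive unchosen terms do not interact: the choices in one segment do not affect the choices in the other, and the whole decomposition is legal exactly when each of these segments is legal. *)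

(* Defs.v *)
From Stdlib Require Export Reals.
From mathcomp Require Export all_boot.
Set Implicit Arguments. Unset Strict Implicit. Unset Printing Implicit Defensive.

(* A decomposition is a coefficient function c : nat -> nat, c i = number of
   copies of a_i used (multiplicity allowed), with finite support. *)
Definition fin_supp (c : nat -> nat) : Prop :=
  exists N, forall i, N <= i -> c i = 0.

Definition is_dec (a : nat -> nat) (c : nat -> nat) (m : nat) : Prop :=
  exists N, (forall i, N <= i -> c i = 0) /\ \sum_(i < N) c i * a i = m.

(* Number of summands (with multiplicity) of a decomposition of m; since
   a is strictly increasing with a_0 > 0, a_i > m for i >= m, so only the
   indices i <= m can carry nonzero coefficients. *)
Definition nsummands (c : nat -> nat) (m : nat) : nat := \sum_(i < m.+1) c i.

Definition mu (a : nat -> nat) (dec : nat -> nat -> nat) (n : nat) : R :=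
  Rdiv (INR (\sum_(a n <= m < a n.+1) nsummands (dec m) m)) (INR (a n.+1 - a n)).

Definition fixed_distance (legal : (nat -> nat) -> Prop) : Prop :=
  exists f : nat, forall (c : nat -> nat) (k : nat),
    fin_supp c ->
    (forall j, k <= j < k + f -> c j = 0) ->
    (exists j, j < k /\ c j <> 0) ->
    (exists j, k + f <= j /\ c j <> 0) ->
    (legal c <->
       (legal (fun j => if j < k then c j else 0) /\
        legal (fun j => if k + f <= j then c j else 0))).

Definition fill (c : nat -> nat) (i : nat) (s : seq nat) : nat -> nat :=
  fun j => if (i <= j) && (j < i + size s) then nth 0 s (j - i) else c j.

Definition segment_density (legal : (nat -> nat) -> Prop) : Prop :=
  forall A : nat, 0 < A ->
  exists (L : nat) (p : R), Rlt 0 p /\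
    forall (i : nat) (c : nat -> nat), fin_supp c ->
      exists l : seq (seq nat),
        uniq l /\
        (forall s, s \in l <-> (size s = L /\ legal (fill c i s))) /\
        Rle (Rmult p (INR (size l))) (INR (count (fun s => A <= sumn s) l)).

(* Main.v *)
Require Import Defs.
From Stdlib Require Import FunctionalExtensionality Lra.
From mathcomp Require Import zify.
Set Implicit Arguments. Unset Strict Implicit. Unset Printing Implicit Defensive.

(** If [C <= 0], then for some constant [T] about half of the integers below
    [x = a_n] have at most [T] summands.  Cutting at gaps of length [f], each of
    their decompositions is a union of legal pieces ("bumps") of bounded length
    with at most [T] summands.  If [K] positions below [n] carry pairwise distant
    bumps, the [2 ^ K] unions of these bumps are legal, and by uniqueness they
    have distinct values, which are [O(x ^ 2)]; so [K = O(log x)].  Hence only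
    [O(log x)] positions occur in decompositions with at most [T] summands, and
    these represent [O((log x) ^ T)] integers, too few to be half of those below
    [x]. *)

(** * Finitely supported coefficient functions and their gaps *)

Definition vanish (n : nat) (c : nat -> nat) : Prop := forall i, n <= i -> c i = 0.

Lemma sum_vanish (n n' : nat) (F : nat -> nat) :
  vanish n F -> vanish n' F -> \sum_(i < n) F i = \sum_(i < n') F i.
Proof.
wlog le_nn' : n n' / n <= n' => [th Fn Fn' | Fn _].
  by case: (leqP n n') => [/th|/ltnW/th]; auto; move=> ->.
rewrite -!(big_mkord xpredT F) [RHS](@big_cat_nat _ _ _ n) //=.
by rewrite [X in _ + X]big_nat_cond [X in _ + X]big1 ?addn0 // => i /andP[/andP[/Fn]].
Qed.

Lemma is_decE (a c : nat -> nat) (n m : nat) :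
  vanish n c -> is_dec a c m <-> \sum_(i < n) c i * a i = m.
Proof.
have va k : vanish k c -> vanish k (fun i => c i * a i) by move=> v i /v ->.
move=> vc; split=> [[N [vN <-]]|<-]; last by exists n.
exact: (sum_vanish (va _ vc) (va _ vN)).
Qed.

(* If no block of length [f] were empty, each of the [t] consecutive blocks
   after [x] would contain a summand. *)
Lemma gap_exists (c : nat -> nat) (f t x : nat) :
  \sum_(x <= i < x + t * f) c i < t ->
  exists2 k, x <= k & k + f <= x + t * f /\ forall j, k <= j < k + f -> c j = 0.
Proof.
elim: t => // t IHt in x *; rewrite mulSn addnA => lt_sum.
case: (boolP (all (fun j => c j == 0) (index_iota x (x + f)))) => [/allP z|].
  exists x => //; split; first exact: leq_addr.
  by move=> j jk; apply/eqP/z; rewrite mem_index_iota.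
rewrite -has_predC => /hasP[j]; rewrite mem_index_iota => /andP[xj jf] /= cj.
have [|k xk [kf z]] := IHt (x + f).
  move: lt_sum; rewrite (@big_cat_nat _ _ _ (x + f)) ?leq_addr //=.
  suff: 0 < \sum_(x <= i < x + f) c i by lia.
  rewrite (bigD1_seq j) ?mem_index_iota ?iota_uniq ?xj //=; lia.
by exists k; [lia | split; [lia|]].
Qed.

(** * Cutting a legal decomposition into short pieces *)

Definition gap_rule (legal : (nat -> nat) -> Prop) (f : nat) : Prop :=
  forall (c : nat -> nat) (k : nat),
    fin_supp c ->
    (forall j, k <= j < k + f -> c j = 0) ->
    (exists j, j < k /\ c j <> 0) ->
    (exists j, k + f <= j /\ c j <> 0) ->
    (legal c <->
       (legal (fun j => if j < k then c j else 0) /\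
        legal (fun j => if k + f <= j then c j else 0))).

Lemma leq_sum_ltn (n : nat) (u c : nat -> nat) (j : nat) :
  (forall i, u i <= c i) -> j < n -> u j < c j ->
  \sum_(i < n) u i < \sum_(i < n) c i.
Proof.
move=> uc jn ucj; rewrite (bigD1 (Ordinal jn)) // [X in _ < X](bigD1 (Ordinal jn)) //=.
by rewrite -addSn leq_add // leq_sum.
Qed.

Lemma sum_window (n T x y : nat) (c : nat -> nat) :
  vanish n c -> \sum_(i < n) c i <= T -> \sum_(x <= i < y) c i <= T.
Proof.
move=> vn; apply: leq_trans.
have vm : vanish (maxn n (maxn x y)) c by move=> i; rewrite geq_max => /andP[/vn].
rewrite (sum_vanish vn vm) -(big_mkord xpredT c).
move: vm; set m := maxn n _ => vm.
case: (leqP x y) => [xy|/ltnW xy]; last by rewrite big_geq.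
have [xm ym] : x <= m /\ y <= m by rewrite /m; lia.
rewrite (@big_cat_nat _ _ _ x 0 m) //=.
rewrite (@big_cat_nat _ _ _ y x m) //=.
by rewrite addnCA leq_addr.
Qed.

(** If a summand lies further than [T.+1 * f] from [j], the at most [T] summands in between miss one
    of [T.+1] blocks of length [f]. Cutting at that block leaves a legal side containing [j] with
    fewer summands, so induction on their number ends with all of them close to [j]. *)
Lemma legal_component (legal : (nat -> nat) -> Prop) (f T n j : nat) (c : nat -> nat) :
  gap_rule legal f -> legal c -> vanish n c -> \sum_(i < n) c i <= T -> c j != 0 ->
  exists u : nat -> nat, [/\ legal u, u j != 0, forall i, u i <= c i
    & forall i, u i != 0 -> i <= j + T.+1 * f /\ j <= i + T.+1 * f].
Proof.
(* The induction is on a separate bound [s], so that [T], and with it the window, stays fixed while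
   summands are removed. *)
move=> Hf; move: {2}(\sum_(i < n) c i) (leqnn (\sum_(i < n) c i)) => s.
elim: s => [|s IHs] in c *.
  rewrite leqn0 sum_nat_eq0 => /forallP z _ vn _; case: (ltnP j n) => [jn|/vn -> //].
  by rewrite (eqP (z (Ordinal jn))).
move=> sum_s lc vn sT cj.
(* The boolean [b] tells whether [j] is the left or the right end of the far pair, hence which side
   of the gap is kept. *)
have cut (b : bool) x y : x + T.+1 * f < y -> c x != 0 -> c y != 0 ->
    j = (if b then x else y) ->
    exists u, [/\ legal u, u j != 0, forall i, u i <= c i
                & exists2 i, i < n & u i < c i].
  move=> xy cx cy jb.
  have nb z : c z != 0 -> z < n by move=> cz; case: (ltnP z n) => // /vn E; rewrite E in cz.
  have [|k xk [kf z]] := @gap_exists c f T.+1 x.+1.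
    by rewrite ltnS; apply: sum_window sT.
  have [] := Hf c k; first by exists n.
  - exact: z.
  - by exists x; split; [lia | apply/eqP].
  - by exists y; split; [lia | apply/eqP].
  case=> // [lL lR] _.
  case: b jb => jb; subst j.
    exists (fun j => if j < k then c j else 0); split=> //.
    - by rewrite xk.
    - by move=> i; case: ifP.
    - exists y; first exact: nb.
      by rewrite ltnNge ifN; lia.
  exists (fun j => if k + f <= j then c j else 0); split=> //.
  - by rewrite ifT //; lia.
  - by move=> i; case: ifP.
  - by exists x; [exact: nb | rewrite ifN; lia].
have rec u : [/\ legal u, u j != 0, forall i, u i <= c i
                & exists2 i, i < n & u i < c i] ->
    exists u : nat -> nat, [/\ legal u, u j != 0, forall i, u i <= c i
    & forall i, u i != 0 -> i <= j + T.+1 * f /\ j <= i + T.+1 * f].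
  case=> lu uj uc [i ni ui].
  have lt_uc := leq_sum_ltn uc ni ui.
  have [||||//|v [lv vj vu vw]] := IHs u; try by [|lia].
    by move=> q /vn cq; have := uc q; rewrite cq; lia.
  by exists v; split=> // q; apply: leq_trans (vu q) (uc q).
case: (boolP [forall i : 'I_n,
  (c i != 0) ==> (i <= j + T.+1 * f) && (j <= i + T.+1 * f)]).
  move=> /forallP win; exists c; split=> // i ci.
  case: (ltnP i n) => [ni|/vn E]; last by rewrite E in ci.
  by move: (win (Ordinal ni)) => /=; rewrite ci => /andP.
case/forallPn => i; rewrite negb_imply negb_and -!ltnNge => /andP[ci /orP[ij|ij]].
  by have [u /rec] := cut true j i ij cj ci erefl.
by have [u /rec] := cut false i j ij ci cj erefl.
Qed.

(** * Gluing distant bumps *)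

Lemma leq_bigD1 (n : nat) (S : {set 'I_n}) (F : 'I_n -> nat) (j : 'I_n) :
  j \in S -> F j <= \sum_(q in S) F q.
Proof. by move=> jS; rewrite (bigD1 j) //= leq_addr. Qed.

Definition bump (legal : (nat -> nat) -> Prop) (n T W j : nat) (u : nat -> nat) :=
  [/\ legal u, u j != 0, vanish n u, \sum_(i < n) u i <= T
    & forall i, u i != 0 -> i <= j + W /\ j <= i + W].

Definition separated (n M : nat) (S : {set 'I_n}) :=
  forall i j : 'I_n, i \in S -> j \in S -> i < j -> i + M <= j.

(** Induction on [#|S|], removing the bump at the largest position [j]. It starts no earlier than
    [j - W], and by separation the others end before [j - W - f], which leaves a gap of length [f]
    between them. *)
Lemma glue_legal (legal : (nat -> nat) -> Prop) (f n T W : nat)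
    (u : 'I_n -> nat -> nat) (S : {set 'I_n}) :
  gap_rule legal f -> (forall j, j \in S -> bump legal n T W j (u j)) ->
  separated (2 * W + f).+1 S -> S != set0 ->
  legal (fun i => \sum_(j in S) u j i).
Proof.
move=> Hf; move: {2}#|S| (leqnn #|S|) => s.
elim: s => [|s IHs] in S *.
  by rewrite leqn0 cards_eq0 => ->.
move=> Ss uS sep /set0Pn[j0 j0S].
case: (arg_maxnP (fun j : 'I_n => j : nat) j0S) => j j_in jmax.
have jS : j \in S by exact: j_in.
have gE i : \sum_(q in S) u q i = u j i + \sum_(q in S :\ j) u q i.
  by rewrite (big_setD1 j jS).
have [lj ujj vj _ wj] := uS j jS.
have sub q : q \in S :\ j -> q \in S /\ q + (2 * W + f).+1 <= j.
  rewrite in_setD1 => /andP[qj qS]; split=> //; apply: sep => //.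
  by rewrite ltn_neqAle qj; exact: jmax.
have zj i : i + W < j -> u j i = 0 by move=> ij; apply/eqP/negPn/negP => /wj; lia.
have zS i : j <= i + W + f -> \sum_(q in S :\ j) u q i = 0.
  move=> ij; apply: big1 => q /sub[qS qj]; have [_ _ _ _ wq] := uS q qS.
  by apply/eqP/negPn/negP => /wq; lia.
(* The gap rule asks for summands on both sides, so a single bump is treated apart. *)
case: (eqVneq (S :\ j) set0) => [S0|/[dup] S'0 /set0Pn[q qS']].
  suff -> : (fun i => \sum_(q in S) u q i) = u j by [].
  by apply: functional_extensionality => i; rewrite gE S0 big_set0 addn0.
have lS' : legal (fun i => \sum_(q in S :\ j) u q i).
  apply: IHs => //.
  - by move: Ss; rewrite (cardsD1 j S) jS.
  - by move=> p /sub[/uS].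
  - by move=> p r /sub[pS _] /sub[rS _]; apply: sep.
have [qS qj] := sub q qS'; have [_ uqq _ _ _] := uS q qS.
have [||||_] := Hf (fun i => \sum_(q in S) u q i) (j - W - f).
- by exists n => i ni; apply: big1 => p /uS[_ _ /(_ i ni)].
- by move=> i ik; rewrite gE zS ?zj //; lia.
- exists q; split; first lia.
  by have := leq_bigD1 (fun q' => u q' q) qS; lia.
- exists j; split; first lia.
  by rewrite gE; lia.
apply; split.
  suff -> : (fun i => if i < j - W - f then \sum_(q in S) u q i else 0) =
            (fun i => \sum_(q in S :\ j) u q i) by [].
  apply: functional_extensionality => i; case: ifPn => [ik|ik].
    by rewrite gE zj //; lia.
  by rewrite zS //; lia.
suff -> : (fun i => if j - W - f + f <= i then \sum_(q in S) u q i else 0) = u j by [].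
apply: functional_extensionality => i; case: ifPn => [ik|ik].
  by rewrite gE zS ?addn0 //; lia.
by rewrite zj //; lia.
Qed.

Definition dec_system (a : nat -> nat) (legal : (nat -> nat) -> Prop)
    (dec : nat -> nat -> nat) :=
  [/\ 0 < a 0, forall n, a n < a n.+1,
      forall m, 0 < m -> legal (dec m) /\ is_dec a (dec m) m
    & forall m (c : nat -> nat), 0 < m -> legal c -> is_dec a c m ->
        forall i, c i = dec m i].

Lemma dec_system_mono a legal dec n m : dec_system a legal dec -> (a n <= a m) = (n <= m).
Proof. by case=> _ lt_a _ _; exact: (leq_mono (homo_ltn ltn_trans lt_a)). Qed.

Lemma dec_system_gt a legal dec n : dec_system a legal dec -> n < a n.
Proof. by case=> a0 lt_a _ _; elim: n => // n IHn; apply: leq_ltn_trans IHn (lt_a n). Qed.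

(* The [2 ^ #|R|] gluings of subsets of the bumps are legal, so by uniqueness
   they decompose distinct numbers, all at most [n * (T * a n)]. *)
Lemma card_separated a legal dec f n T W (R : {set 'I_n}) :
  dec_system a legal dec -> gap_rule legal f ->
  (forall j, j \in R -> exists u, bump legal n T W j u) ->
  separated (2 * W + f).+1 R -> 2 ^ #|R| <= (n * (T * a n)).+1.
Proof.
move=> ds Hf exu sep.
have [u uR] : exists u : 'I_n -> nat -> nat, forall j, j \in R -> bump legal n T W j (u j).
  apply: (@fin_all_exists _ (fun=> nat -> nat) (fun j uj => j \in R -> bump legal n T W j uj)).
  by move=> j; case: (boolP (j \in R)) => [/exu[v]|_]; [exists v | exists id].
pose glue (S : {set 'I_n}) i := \sum_(j in S) u j i.
pose val S := \sum_(i < n) glue S i * a i.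
(* No bump at another position of [R] reaches [j], so [S] can be read off from [glue S]. *)
have memE (S : {set 'I_n}) (j : 'I_n) : S \subset R -> j \in R -> (j \in S) = (glue S j != 0).
  move=> /subsetP SR jR; case: (boolP (j \in S)) => jS.
    have [_ ujj _ _ _] := uR j jR.
    by have := leq_bigD1 (fun q => u q j) jS; rewrite /glue; lia.
  rewrite /glue big1 // => q qS; apply/eqP/negPn/negP.
  have [_ _ _ _ w] := uR q (SR q qS); move/w.
  have := sep q j (SR q qS) jR; have := sep j q jR (SR q qS).
  by case: (ltngtP q j) => [_|_|/val_inj E]; [lia | lia | rewrite -E qS in jS].
have agt0 i : 0 < a i by apply: leq_ltn_trans (dec_system_gt i ds).
(* Uniqueness concerns positive integers only; the empty union, of value 0, must be told apart by
   hand. *)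
have val0 (S : {set 'I_n}) : S \subset R -> (val S == 0) = (S == set0).
  move=> SR; apply/eqP/eqP => [v0|->]; last first.
    by rewrite /val big1 // => i _; rewrite /glue big_set0.
  apply/eqP/negPn/negP => /set0Pn[j jS].
  have jR := subsetP SR j jS.
  have : glue S j * a j <= val S by rewrite /val (bigD1 j) //= leq_addr.
  by rewrite v0 leqn0 muln_eq0 -[glue S j == 0]negbK -memE // jS /= -[a j == 0]negbK -lt0n agt0.
have decE (S : {set 'I_n}) : S \subset R -> S != set0 -> forall i, glue S i = dec (val S) i.
  move=> SR S0; have [_ _ _ uniq_dec] := ds; apply: uniq_dec.
  - by rewrite lt0n val0.
  - apply: glue_legal Hf _ _ S0 => [j jS|p q pS qS]; first exact: uR (subsetP SR j jS).
    by apply: sep; exact: subsetP SR _ _.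
  - apply/(@is_decE _ _ n) => //.
    by move=> i ni; apply: big1 => j /(subsetP SR)/uR[_ _ /(_ i ni)].
have val_inj : {in powerset R &, injective val}.
  move=> S S'; rewrite !powersetE => SR S'R vE.
  have := val0 S SR; rewrite vE val0 //.
  case: (eqVneq S' set0) => [-> /esym/eqP //|S'0 /esym/negbT S0].
  apply/setP => j; case: (boolP (j \in R)) => jR; last first.
    by rewrite !(contraNF (subsetP _ j) jR).
  by rewrite (memE S) ?(memE S') ?(decE S) ?(decE S') ?vE.
have val_le (S : {set 'I_n}) : S \subset R -> val S <= n * (T * a n).
  move=> SR; rewrite /val /glue; under eq_bigr do rewrite big_distrl /=.
  rewrite exchange_big /=; apply: (@leq_trans (\sum_(j in S) T * a n)); last first.
    by rewrite sum_nat_const leq_mul2r (leq_trans (max_card _)) ?card_ord ?orbT.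
  apply: leq_sum => j jS; have [_ _ _ sT _] := uR j (subsetP SR j jS).
  apply: leq_trans (leq_mul sT (leqnn _)); rewrite big_distrl leq_sum // => i _.
  by rewrite leq_mul2l (dec_system_mono _ _ ds) ltnW ?orbT.
rewrite -card_powerset.
have inj : {in powerset R &, injective (fun S => inord (val S) : 'I_(n * (T * a n)).+1)}.
  move=> S S' SR S'R /(congr1 (@nat_of_ord _)).
  rewrite !inordK ?ltnS ?val_le -?powersetE //; exact: val_inj.
by rewrite -(card_in_imset inj) (leq_trans (max_card _)) ?card_ord.
Qed.

(** * Integers with few summands and the positions they use *)

Lemma dec_system_vanish a legal dec n m :
  dec_system a legal dec -> 0 < m -> m < a n -> vanish n (dec m).
Proof.
move=> ds m0 mn i ni; have [_ _ /(_ m m0)[_ [k [vk sk]]] _] := ds.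
apply/eqP/negPn/negP => ci; case: (ltnP i k) => [ik|/vk E]; last by rewrite E in ci.
have : dec m i * a i <= m by rewrite -[X in _ <= X]sk (bigD1 (Ordinal ik)) //= leq_addr.
have : a n <= a i by rewrite (dec_system_mono _ _ ds).
by nia.
Qed.

Lemma dec_system_val a legal dec n m :
  dec_system a legal dec -> 0 < m -> m < a n -> \sum_(i < n) dec m i * a i = m.
Proof.
move=> ds m0 mn; have [_ _ /(_ m m0)[_ dm] _] := ds.
exact: (proj1 (@is_decE a (dec m) n m (dec_system_vanish ds m0 mn)) dm).
Qed.

Lemma nsummandsE a legal dec n m :
  dec_system a legal dec -> 0 < m -> m < a n ->
  nsummands (dec m) m = \sum_(i < n) dec m i.
Proof.
move=> ds m0 mn; apply: sum_vanish (dec_system_vanish ds m0 mn).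
by apply: (dec_system_vanish ds m0); apply/ltnW/(dec_system_gt _ ds).
Qed.

(** The guard [0 < m] is there because [dec 0] is unconstrained. *)
Definition sparse (dec : nat -> nat -> nat) (T m : nat) : bool :=
  (0 < m) && (nsummands (dec m) m <= T).

Definition sparse_pos (a : nat -> nat) (dec : nat -> nat -> nat) (T n : nat) : {set 'I_n} :=
  [set j : 'I_n | [exists m : 'I_(a n), sparse dec T m && (dec m j != 0)]].

Lemma sparse_pos_bump a legal dec f T n j :
  dec_system a legal dec -> gap_rule legal f -> j \in sparse_pos a dec T n ->
  exists u, bump legal n T (T.+1 * f) j u.
Proof.
move=> ds Hf; rewrite inE => /existsP[m /andP[/andP[m0 mT] cj]].
have vm := dec_system_vanish ds m0 (ltn_ord m).
rewrite (nsummandsE ds m0 (ltn_ord m)) in mT.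
have [_ _ /(_ m m0)[lm _] _] := ds.
have [u [lu uj um uw]] := legal_component Hf lm vm mT cj.
exists u; split=> //.
  by move=> i /vm E; apply/eqP; rewrite -leqn0 -E.
by apply: leq_trans mT; apply: leq_sum.
Qed.

(** Distinct positions congruent modulo [M.+1] differ by at least [M.+1], so each of the [M.+1]
    residue classes of [Q] is separated. *)
Lemma card_residues (n M K : nat) (Q : {set 'I_n}) :
  (forall R : {set 'I_n}, R \subset Q -> separated M.+1 R -> #|R| <= K) ->
  #|Q| <= M.+1 * K.
Proof.
move=> QK.
rewrite -sum1_card (partition_big (fun j : 'I_n => inord (j %% M.+1) : 'I_M.+1) predT) //=.
rewrite -[X in X * K]card_ord -sum_nat_const leq_sum // => r _.
rewrite sum1dep_card; apply: QK.
  by apply/subsetP => j; rewrite inE => /andP[].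
move=> i j; rewrite !inE => /andP[_ /eqP/(congr1 val)] /=.
rewrite inordK ?ltn_mod // => iE /andP[_ /eqP/(congr1 val)] /=.
rewrite inordK ?ltn_mod // => jE ij.
have := divn_eq j M.+1; have := divn_eq i M.+1; rewrite iE jE => Ei Ej.
have : i %/ M.+1 < j %/ M.+1 by rewrite -(ltn_pmul2r (ltn0Sn M)); lia.
by rewrite -(leq_pmul2r (ltn0Sn M)) mulSn; lia.
Qed.

(** The added [0] pads shorter sums, so that all sums of at most [t] entries, with repetition, are
    covered. *)
Fixpoint sums (s : seq nat) (t : nat) : seq nat :=
  if t is t'.+1 then [seq x + y | x <- 0 :: s, y <- sums s t'] else [:: 0].

Lemma size_sums s t : size (sums s t) = (size s).+1 ^ t.
Proof. by elim: t => //= t IHt; rewrite size_cat size_map size_allpairs IHt expnS mulSn. Qed.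

Lemma mem_sums (a c : nat -> nat) (n t : nat) (s : seq nat) :
  (forall i, i < n -> c i != 0 -> a i \in s) -> \sum_(i < n) c i <= t ->
  \sum_(i < n) c i * a i \in sums s t.
Proof.
elim: t => [|t IHt] in c *; move=> cs ct.
  rewrite big1 ?inE // => i _; move: ct; rewrite leqn0 sum_nat_eq0 => /forallP/(_ i)/eqP -> //.
have step x y : x \in 0 :: s -> y \in sums s t -> x + y \in sums s t.+1
  by exact: allpairs_f.
case: (boolP [exists i : 'I_n, c i != 0]) => [/existsP[j cj]|/existsPn c0]; last first.
  rewrite -[X in X \in _]add0n; apply: step; first exact: mem_head.
  by apply: IHt => //; rewrite big1 // => i _; exact/eqP/negPn/c0.
(* One copy of [a j] is removed. The identity below is used with [a] for the value and with the
   constant 1 for the number of summands. *)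
pose c' (i : nat) := if i == j :> nat then (c i).-1 else c i.
have sumE (F : nat -> nat) : \sum_(i < n) c i * F i = F j + \sum_(i < n) c' i * F i.
  rewrite (bigD1 j) // [in RHS](bigD1 j) //= /c' eqxx addnA -mulSn prednK ?lt0n //.
  by congr addn; apply: eq_bigr => i ij; rewrite ifN.
rewrite (sumE a); apply: step.
  by rewrite inE cs ?orbT.
apply: IHt => [i ni|].
  by rewrite /c'; case: (i =P j :> nat) => [-> _|_ /cs]; auto.
have := sumE (fun=> 1); under eq_bigr do rewrite muln1.
under [X in _ = _ + X]eq_bigr do rewrite muln1.
by move=> E; move: ct; rewrite E add1n ltnS.
Qed.

(** A sparse integer below [a n] is a sum of at most [T] terms [a j] with [j] in [sparse_pos], hence
    an entry of a list of length [#|Q|.+1 ^ T]. *)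
Lemma count_sparse a legal dec T n x0 :
  dec_system a legal dec ->
  count (sparse dec T) (index_iota x0 (a n)) <= #|sparse_pos a dec T n|.+1 ^ T.
Proof.
move=> ds; set Q := sparse_pos a dec T n.
have -> : #|Q| = size [seq a (j : nat) | j : 'I_n <- enum Q] by rewrite size_map -cardE.
rewrite -size_sums -size_filter; apply: uniq_leq_size; first exact/filter_uniq/iota_uniq.
move=> m; rewrite mem_filter mem_index_iota => /andP[sm /andP[_ mn]].
have /andP[m0 mT] := sm.
rewrite -(dec_system_val ds m0 mn); apply: mem_sums; last by rewrite -(nsummandsE ds m0 mn).
move=> i ni ci; apply/mapP; exists (Ordinal ni) => //.
by rewrite mem_enum inE; apply/existsP; exists (Ordinal mn); rewrite /= sm.
Qed.

(** * Comparison of growth and conclusion *)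

(** With [q = e %/ k.+1], [e.+1 <= k.+1 * q.+1 <= k.+1 * 2 ^ q]. Raising this to the power [k.+1]
    bounds [e.+1 ^ k.+1] by a constant times [2 ^ e], and the spare factor [e.+1] absorbs that
    constant and [A]. *)
Lemma exp_dominates_poly (A k : nat) : exists E, forall e, E <= e -> A * e.+1 ^ k < 2 ^ e.
Proof.
exists (A * k.+1 ^ k.+1) => e Ee.
have bound : e.+1 ^ k.+1 <= k.+1 ^ k.+1 * 2 ^ e.
  apply: (@leq_trans ((k.+1 * 2 ^ (e %/ k.+1)) ^ k.+1)).
    rewrite leq_exp2r // mulnC; apply: leq_trans (ltn_ceil e (ltn0Sn k)) _.
    by rewrite leq_mul2r ltn_expl ?orbT.
  by rewrite expnMn leq_mul2l -expnM leq_exp2l // leq_divM orbT.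
rewrite -(ltn_pmul2r (ltn0Sn e)) -mulnA -expnSr.
apply: leq_ltn_trans (leq_mul (leqnn A) bound) _.
by rewrite mulnA mulnC ltn_pmul2l ?expn_gt0.
Qed.

Lemma unbounded_average a legal dec f T0 N0 :
  dec_system a legal dec -> gap_rule legal f ->
  ~ (forall n, N0 <= n ->
       \sum_(a n <= m < a n.+1) nsummands (dec m) m <= T0 * (a n.+1 - a n)).
Proof.
move=> ds Hf avg.
have mono n m : n <= m -> a n <= a m by rewrite (dec_system_mono _ _ ds).
have total n : N0 <= n ->
    \sum_(a N0 <= m < a n) nsummands (dec m) m <= T0 * (a n - a N0).
  elim: n => [|n IHn]; first by rewrite leqn0 => /eqP ->; rewrite big_geq.
  rewrite leq_eqVlt => /orP[/eqP <-|]; first by rewrite big_geq.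
  rewrite ltnS => Nn; rewrite (@big_cat_nat _ _ _ (a n)) ?mono //=.
  have := leq_add (IHn Nn) (avg n Nn); rewrite -mulnDr => /leq_trans; apply.
  by rewrite leq_mul2l; have := mono _ _ Nn; have := mono _ _ (leqnSn n); lia.
(* Twice the average bound: by Markov's inequality, at least half of the integers in [[a N0, a n)]
   then have at most [T] summands. *)
have [T ET] : exists T, T = 2 * T0 by exists (2 * T0).
pose W := T.+1 * f; pose M := 2 * W + f.
have half n : N0 <= n -> a n <= a N0 + 2 * count (sparse dec T) (index_iota (a N0) (a n)).
  move=> Nn; have := total n Nn; set s := index_iota _ _.
  have szs : size s = a n - a N0 by rewrite size_iota.
  have gt0 : forall m, m \in s -> 0 < m.
    move=> m; rewrite mem_index_iota => /andP[+ _]; apply: leq_trans.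
    by apply: leq_ltn_trans (dec_system_gt N0 ds).
  have : T.+1 * count (predC (sparse dec T)) s <= \sum_(m <- s) nsummands (dec m) m.
    rewrite -sum1_count big_distrr /= big_mkcond /= [X in X <= _]big_seq [X in _ <= X]big_seq.
    apply: leq_sum => m /gt0 m0; rewrite /sparse m0 /= -ltnNge.
    by case: ifP; rewrite ?muln1.
  have := count_predC (sparse dec T) s; rewrite szs ET; nia.
(* For separated [R], [2 ^ #|R| <= (n * (T * a n)).+1], where [T < 2 ^ T] and [n < a n < 2 ^ e.+1];
   this gives the exponent [T + 2 * e + 2]. *)
have card_pos n : #|sparse_pos a dec T n| <= M.+1 * (T + 2 * trunc_log 2 (a n) + 2).
  set e := trunc_log 2 (a n); apply: card_residues => R /subsetP RQ sep.
  have := @card_separated a legal dec f n T W R ds Hf.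
  move=> /(_ (fun j jR => sparse_pos_bump ds Hf (RQ j jR)) sep).
  have an : a n < 2 ^ e.+1 by apply: trunc_log_ltn.
  have nan := dec_system_gt n ds; have T2 : T < 2 ^ T by apply: ltn_expl.
  move=> leR; rewrite -(@leq_exp2l 2) //; apply: leq_trans leR _.
  have -> : T + 2 * e + 2 = T + (e.+1 + e.+1) by lia.
  rewrite !expnD mulnCA; apply: (ltn_mul T2).
  exact: (ltn_mul (ltn_trans nan an) an).
(* Chosen so that [card_pos] yields [#|sparse_pos a dec T n|.+1 <= B * e.+1]. *)
pose B := M.+1 * (T + 4) + 1.
have [E HE] := exp_dominates_poly (a N0 + 2 * B ^ T) T.
(* As [a n > n >= 2 ^ E], the logarithm [e] reaches [E]. Then [2 ^ e <= a n <= a N0 + 2 * (B * e.+1)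
   ^ T] contradicts the choice of [E]. *)
pose n := maxn N0 (2 ^ E); set e := trunc_log 2 (a n).
have an0 : 0 < a n by apply: leq_ltn_trans (dec_system_gt n ds).
have Ee : E <= e.
  apply: trunc_log_max => //; apply: leq_trans (ltnW (dec_system_gt n ds)).
  exact: leq_maxr.
have := HE e Ee; rewrite ltnNge => /negP; apply.
apply: leq_trans (trunc_logP _ an0) _ => //; apply: leq_trans (half n (leq_maxl _ _)) _.
rewrite mulnDl leq_add //.
  by rewrite leq_pmulr // expn_gt0.
rewrite -mulnA leq_mul2l /=; apply: leq_trans (count_sparse _ _ _ ds) _.
rewrite -expnMn; case: (posnP T) => [-> //|Tgt0].
rewrite leq_exp2r //; have := card_pos n; rewrite -/e /B; nia.
Qed.

Theorem theorem2p2
  (a : nat -> nat) (legal : (nat -> nat) -> Prop) (dec : nat -> nat -> nat)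
  (C d : R)
  (a_pos : 0 < a 0)
  (a_incr : forall n, a n < a n.+1)
  (dec_legal : forall m, 0 < m -> legal (dec m) /\ is_dec a (dec m) m)
  (dec_unique : forall m (c : nat -> nat), 0 < m -> legal c -> is_dec a c m ->
                  forall i, c i = dec m i)
  (H1 : fixed_distance legal)
  (H2 : forall eps : R, Rlt 0 eps -> exists N : nat, forall n, N <= n ->
          Rlt (Rabs (Rminus (mu a dec n) (Rplus (Rmult C (INR n)) d))) eps)
  (H3 : segment_density legal) :
  Rlt 0 C.
Proof.
have [f Hf] := H1.
have ds : dec_system a legal dec by split.
case: (Rlt_le_dec 0 C) => // C0.
have [N0 muN] := H2 _ Rlt_0_1.
(* With error 1 and [C <= 0], every average from [N0] on is below [d + 1], hence at most [T0]. *)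
have [T0 dT0] : exists T0, Rle (d + 1) (INR T0).
  have [k Hk] := INR_unbounded (d + 1).
  by exists k; lra.
case: (@unbounded_average a legal dec f T0 N0 ds Hf) => n /muN.
rewrite /mu; set S := \sum_(_ <= _ < _) _; set D := a n.+1 - a n => close.
have D0 : Rlt 0 (INR D) by apply: lt_0_INR; have := a_incr n; lia.
apply/leP/INR_le; rewrite mult_INR.
have Cn : Rle (C * INR n) 0.
  by have := pos_INR n; nra.
have : Rle (INR S / INR D) (INR T0).
  by move: (Rle_abs (INR S / INR D - (C * INR n + d))); lra.
move/(Rmult_le_compat_r _ _ _ (Rlt_le _ _ D0)).
by rewrite /Rdiv Rmult_assoc Rinv_l ?Rmult_1_r //; lra.
Qed.
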